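(* Let $q$ be a power of a prime $p$ and let $k$ be an integer with $3\le k\le q+1$. Let $F_{k,p}=\{a\in\{0,1,\dots,k\}:a\not\le_p k\}$. Then $F_{k,p}$ consists of a single orbit under the involution $a\mapsto k-a$ if and only if one of the following holds: (i) $p=2$ and $k=5$; (ii) $p$ is odd and $k\in\{2p-3,\,2p-2,\,3p-2\}$.
   Context: For nonnegative integers $a,k$ with base-$p$ expansions $a=\sum_r a_rp^r$, $k=\sum_r k_rp^r$ ($0\le a_r,k_r\le p-1$), write $a\le_p k$ if $a_r\le k_r$ for all $r$. The set $F_{k,p}$ is stable under the involution $a\mapsto k-a$ of $\{0,1,\dots,k\}$; ''consists of a single orbit'' means that $F_{k,p}$ is nonempty and equals $\{a,k-a\}$ for some $a$ (possibly $a=k-a$). *)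

(* Defs.v *)
From mathcomp Require Import all_boot.
From mathcomp Require Import classical_sets.

Set Implicit Arguments.
Unset Strict Implicit.
Unset Printing Implicit Defensive.

Local Open Scope classical_set_scope.

(* The coefficient of p ^ r in the base-p expansion of a, for p > 1. *)
Definition digit (p a r : nat) : nat := (a %/ p ^ r) %% p.

Definition digit_le (p a k : nat) : Prop :=
  forall r : nat, digit p a r <= digit p k r.

Definition F (k p : nat) : set nat := [set a | a <= k /\ ~ digit_le p a k].

(* The subtraction k - a is exact because a <= k. *)
Definition single_orbit (k : nat) (A : set nat) : Prop :=
  A !=set0 /\ exists a : nat, a <= k /\ A = [set a; k - a].

(* Main.v *)
Require Import Defs.
From mathcomp Require Import all_boot.
From mathcomp Require Import classical_sets.
From mathcomp Require Import zify.

(** Write [k = u * p + r] and [a = v * p + s] with [r, s < p]. Then [a] lies in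
    [F k p] iff either [r < s] and [v < u], or [s <= r] and [v] lies in
    [F u p]. Each residue [s > r] thus contributes [u] elements to [F k p], and
    each element of [F u p] contributes [r + 1] of them. Three distinct elements
    rule out a single orbit, which leaves only the listed values; for [p = 2]
    and [r = 1] the recursion has to be unfolded once more. *)

Lemma digit_le_recP (p u r v s : nat) : r < p -> s < p ->
  digit_le p (v * p + s) (u * p + r) <-> s <= r /\ digit_le p v u.
Proof.
move=> ltrp ltsp; have p_gt0 : 0 < p by apply: leq_ltn_trans ltrp.
have digit0 w t : t < p -> digit p (w * p + t) 0 = t.
  by move=> lttp; rewrite /digit expn0 divn1 modnMDl modn_small.
have digitS w t i : t < p -> digit p (w * p + t) i.+1 = digit p w i.
  by move=> lttp; rewrite /digit expnS divnMA divnMDl // (divn_small lttp) addn0.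
split=> [le_dig | [le_sr le_vu] [|i]]; last 2 first.
- by rewrite !digit0.
- by rewrite !digitS.
split=> [|i]; first by have := le_dig 0; rewrite !digit0.
by have := le_dig i.+1; rewrite !digitS.
Qed.

(** If [s <= r], the last digit imposes nothing and the size bound reduces to [v <= u]. If [r < s],
    the last digit already violates [digit_le], and the size bound becomes [v < u]. *)
Lemma F_recP (p u r v s : nat) : r < p -> s < p ->
  F (u * p + r) p (v * p + s) <->
  (r < s /\ v < u) \/ (s <= r /\ F u p v).
Proof.
move=> ltrp ltsp; rewrite /F /= digit_le_recP //.
have [le_sr | lt_rs] := leqP s r.
  have -> : (v * p + s <= u * p + r) = (v <= u) by nia.
  by intuition.
have -> : (v * p + s <= u * p + r) = (v < u) by nia.
have nle : ~ (s <= r) by lia.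
by intuition.
Qed.

Lemma F_quotP (p u r a : nat) : r < p ->
  F (u * p + r) p a <->
  (r < a %% p /\ a %/ p < u) \/ (a %% p <= r /\ F u p (a %/ p)).
Proof.
move=> ltrp; rewrite {1}(divn_eq a p); apply: F_recP => //.
by rewrite ltn_mod; apply: leq_ltn_trans ltrp.
Qed.

(** For a one-digit [u], digitwise domination is the usual order. *)
Lemma F_small (p u a : nat) : u < p -> ~ F u p a.
Proof.
move=> ltup Fa; have le_au : a <= u by case: Fa.
have := F_recP p 0 u 0 a ltup (leq_ltn_trans le_au ltup).
rewrite !mul0n !add0n => -[/(_ Fa)[[] // | [_ [_ ndig]]] _].
exact: ndig.
Qed.

Lemma F_small_quotP (p u r a : nat) : u < p -> r < p ->
  F (u * p + r) p a <-> r < a %% p /\ a %/ p < u.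
Proof.
move=> ltup ltrp; rewrite F_quotP //.
by have := @F_small p u (a %/ p) ltup; intuition.
Qed.

Lemma single_orbit_le2 (k : nat) (A : set nat) (x y z : nat) :
  single_orbit k A -> A x -> A y -> A z -> [\/ x = y, x = z | y = z].
Proof.
move=> [_ [a [_ ->]]] [->|->] [->|->] [->|->];
  by [apply: Or31 | apply: Or32 | apply: Or33].
Qed.

Lemma single_orbitI (k : nat) (A : set nat) (c : nat) : c <= k ->
  (forall a, A a <-> a = c \/ a = k - c) -> single_orbit k A.
Proof.
move=> le_ck AE; split; first by exists c; apply/AE; left.
by exists c; split=> //; apply/seteqP; split=> a /AE.
Qed.

Lemma single_orbit_odd (p u r : nat) : 2 < p -> r < p ->
  single_orbit (u * p + r) (F (u * p + r) p) ->
  [\/ u * p + r = 2 * p - 3, u * p + r = 2 * p - 2 | u * p + r = 3 * p - 2].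
Proof.
move=> p_gt2 ltrp orb.
have Fhigh v s : s < p -> r < s -> v < u -> F (u * p + r) p (v * p + s).
  by move=> ltsp ? ?; apply/F_recP => //; left.
have [ltr1p | ger] := ltnP r p.-1; last first.
  (* Here [r = p - 1], so no residue exceeds [r]. Nonemptiness then yields an element of [F u p],
     which combines with the residues 0, 1, 2. *)
  have [[a /(F_quotP _ _ _ _ ltrp)[[lt_ra _] | [_ Fa]]] _] := orb.
    by have := ltn_pmod a (ltnW (ltnW p_gt2)); lia.
  have Flow s : s < 3 -> F (u * p + r) p (a %/ p * p + s).
    by move=> lts3; apply/F_recP; [lia | lia | right; split; [lia |]].
  have [] := single_orbit_le2 _ _ _ _ _ orb (Flow 0 _) (Flow 1 _) (Flow 2 _);
    by lia.
have [u_gt2 | u_le2] := ltnP 2 u.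
  have [] := single_orbit_le2 _ _ _ _ _ orb
    (Fhigh 0 p.-1 _ _ _) (Fhigh 1 p.-1 _ _ _) (Fhigh 2 p.-1 _ _ _); by lia.
(* [u = 0] makes the set empty. [u = 1] allows at most two residues above [r], and [u = 2] only
   one. *)
case: u u_le2 orb Fhigh => [|[|[|//]]] _ orb Fhigh.
- have [[a Fa] _] := orb.
  by case: (F_small p r a ltrp).
- have [ltr3 | ger3] := ltnP r (p - 3); last first.
    have [eqr|eqr] : r = p - 3 \/ r = p - 2 by lia.
      by apply: Or31; lia.
    by apply: Or32; lia.
  have [] := single_orbit_le2 _ _ _ _ _ orb
    (Fhigh 0 (p - 1) _ _ _) (Fhigh 0 (p - 2) _ _ _) (Fhigh 0 (p - 3) _ _ _);
    by lia.
have [ltr2 | ger2] := ltnP r (p - 2); last by apply: Or33; lia.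
have [] := single_orbit_le2 _ _ _ _ _ orb
  (Fhigh 0 (p - 1) _ _ _) (Fhigh 0 (p - 2) _ _ _) (Fhigh 1 (p - 1) _ _ _);
  by lia.
Qed.

Lemma F_even_odd (u v : nat) : v < u -> F (u * 2 + 0) 2 (v * 2 + 1).
Proof. by move=> ltvu; apply/F_recP => //; left. Qed.

Lemma F_odd_double (u v s : nat) : s < 2 -> F u 2 v -> F (u * 2 + 1) 2 (v * 2 + s).
Proof. by move=> lts2 Fv; apply/F_recP => //; right. Qed.

Lemma F22P (a : nat) : F 2 2 a <-> a = 1.
Proof. by rewrite (F_small_quotP 2 1 0) //; split=> [[]|->] //; lia. Qed.

Lemma F52P (a : nat) : F 5 2 a <-> a = 2 \/ a = 3.
Proof. by rewrite (F_quotP 2 2 1) // F22P; lia. Qed.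

Lemma single_orbit_two (k : nat) : 2 < k -> single_orbit k (F k 2) -> k = 5.
Proof.
rewrite (divn_eq k 2); have := ltn_pmod k (isT : 0 < 2).
move: (k %/ 2) (k %% 2) => u [|[|//]] _ k_gt2 orb.
  have [u_gt2 | u_le2] := ltnP 2 u.
    have [] := single_orbit_le2 _ _ _ _ _ orb
      (F_even_odd u 0 _) (F_even_odd u 1 _) (F_even_odd u 2 _); by lia.
  have eq_u : u = 2 by lia.
  (* For [k = 4] the odd elements 1 and 3 are joined by 2, which comes from [F 2 2]. *)
  subst u; have F4 : F (2 * 2 + 0) 2 (1 * 2 + 0).
    by apply/F_recP => //; right; split=> //; apply/F22P.
  have [] := single_orbit_le2 _ _ _ _ _ orb
    (F_even_odd 2 0 _) (F_even_odd 2 1 _) F4; by lia.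
(* Now [k] is odd: each element of [F u 2] gives two of [F k 2], so [F u 2] must be a singleton. *)
have Fu_uniq v w : F u 2 v -> F u 2 w -> v = w.
  move=> Fv Fw.
  have [] := single_orbit_le2 _ _ _ _ _ orb (F_odd_double u v 0 _ Fv)
    (F_odd_double u v 1 _ Fv) (F_odd_double u w 0 _ Fw); by lia.
have [v Fv] : exists v, F u 2 v.
  have [[a /(F_quotP 2 u 1 a isT)[[lt1a _] | [_ Fa]]] _] := orb; last first.
    by exists (a %/ 2).
  by have := ltn_pmod a (isT : 0 < 2); lia.
(* An even [u = 2 * w] has [w] odd elements in [F u 2], forcing [w = 1] and [k = 5]. For odd [u] the
   elements come in pairs, so [F u 2] is no singleton. *)
clear orb k_gt2; move: Fv Fu_uniq; rewrite (divn_eq u 2).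
have := ltn_pmod u (isT : 0 < 2).
move: (u %/ 2) (u %% 2) => w [|[|//]] _ Fv Fu_uniq.
  have [w_gt1 | w_le1] := ltnP 1 w.
    have := Fu_uniq _ _ (F_even_odd w 0 _) (F_even_odd w 1 _); by lia.
  case: w w_le1 Fv {Fu_uniq} => [|[|//]] _ Fv //.
  by case: (F_small 2 0 v).
have [[lt1 _] | [_ Fw]] := (F_quotP 2 w 1 v isT).1 Fv.
  by have := ltn_pmod v (isT : 0 < 2); lia.
have := Fu_uniq _ _ (F_odd_double _ _ 0 _ Fw) (F_odd_double _ _ 1 _ Fw).
by lia.
Qed.

Theorem theorem3 (p m q k : nat) (hp : prime p) (hm : 0 < m) (hq : q = p ^ m)
    (hk3 : 3 <= k) (hkq : k <= q + 1) :
  single_orbit k (F k p) <->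
  (p = 2 /\ k = 5) \/
  (odd p /\ (k = 2 * p - 3 \/ k = 2 * p - 2 \/ k = 3 * p - 2)).
Proof.
have p_gt1 := prime_gt1 hp; split=> [orb | [[-> ->] | [p_odd kE]]].
- have [p2 | p_odd] := even_prime hp.
    by left; subst p; split=> //; apply: single_orbit_two.
  right; split=> //; rewrite (divn_eq k p) in orb *.
  have p_gt2 : 2 < p by lia.
  have ltrp : k %% p < p by rewrite ltn_mod; lia.
  by case: (single_orbit_odd p _ _ p_gt2 ltrp orb); intuition.
- by apply: (single_orbitI 5 _ 2) => // a; rewrite F52P.
have p_gt2 : 2 < p by lia.
(* The witness [p - 1] has quotient 0 and the largest residue. Its partner [k - (p - 1)] is [p - 2],
   [p - 1] or [2 * p - 1] in the three cases. *)
have single_of u r : u < p -> r < p -> k = u * p + r ->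
    (forall v s, s < p -> (r < s /\ v < u <->
       v * p + s = p - 1 \/ v * p + s = k - (p - 1))) -> p - 1 <= k ->
  single_orbit k (F k p).
  move=> ltup ltrp eqk vsE le_ck; apply: (single_orbitI _ _ (p - 1)) => // a.
  rewrite {1}eqk F_small_quotP // {3 4}(divn_eq a p) -vsE //.
  by rewrite ltn_mod; lia.
case: kE => [|[]] kE.
- by apply: (single_of 1 (p - 3)); try lia; move=> [|v] s ltsp; nia.
- by apply: (single_of 1 (p - 2)); try lia; move=> [|v] s ltsp; nia.
by apply: (single_of 2 (p - 2)); try lia; move=> [|[|v]] s ltsp; nia.
Qed.
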